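(* Let $N$ be a manifold, let $k\geq 1$ and $\ell\geq 0$ be integers, and let $X$ be a $k$-contact Lie system on $N$ (i.e. a $t$-dependent vector field $X$ on $N$ for which there is a $k$-contact form $\boldsymbol\eta_N$ on $N$ such that $(N,\boldsymbol\eta_N,X)$ is a $k$-contact Lie system). Then the diagonal prolongation $X^{[\ell+1]}$ of $X$ to $N^{\ell+1}$ is a $k(\ell+1)$-contact Lie system on $N^{\ell+1}$.
   Context: Manifolds are smooth, Hausdorff, connected and finite-dimensional; all structures are smooth. $\{e_1,\dots,e_k\}$ is a basis of $\mathbb{R}^k$. **$k$-contact form.** An $\mathbb{R}^k$-valued one-form $\boldsymbol\eta=\sum_{\alpha=1}^k\eta^\alpha\otimes e_\alpha\in\Omega^1(M,\mathbb{R}^k)$ on a manifold $M$ is a $k$-contact form if (1) $\ker\boldsymbol\eta=\bigcap_\alpha\ker\eta^\alpha\subset TM$ is a regular non-zero distribution of corank $k$; (2) $\ker d\boldsymbol\eta=\bigcap_\alpha\ker d\eta^\alpha\subset TM$ is a regular distribution of rank $k$; (3) $\ker\boldsymbol\eta\cap\ker d\boldsymbol\eta=0$. **$\boldsymbol\eta$-Hamiltonian vector field.** A vector field $Y$ on $M$ such that $[Y,Z]$ takes values in $\ker\boldsymbol\eta$ for every vector field $Z$ taking values in $\ker\boldsymbol\eta$. **Lie systems.** A $t$-dependent vector field on $M$ is a smooth map $X:\mathbb{R}\times M\to TM$ with $X(t,x)\in T_xM$; it is identified with the family $\{X_t\}_{t\in\mathbb{R}}$ of vector fields $X_t=X(t,\cdot)$.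 It is a Lie system if $X_t=\sum_{\alpha=1}^r b_\alpha(t)X_\alpha$ for functions $b_1,\dots,b_r$ of $t$ and vector fields $X_1,\dots,X_r$ spanning an $r$-dimensional real Lie algebra of vector fields (a Vessiot--Guldberg Lie algebra of $X$). The smallest Lie algebra $V^X$ of $X$ is the smallest real Lie algebra of vector fields containing all $X_t$, $t\in\mathbb{R}$. **$k$-contact Lie system.** A triple $(M,\boldsymbol\eta,X)$, where $\boldsymbol\eta$ is a $k$-contact form on $M$ and $X$ is a Lie system on $M$ such that all elements of $V^X$ are $\boldsymbol\eta$-Hamiltonian vector fields. $X$ itself is called a $k$-contact Lie system if some $k$-contact form $\boldsymbol\eta$ makes $(M,\boldsymbol\eta,X)$ a $k$-contact Lie system. **Diagonal prolongation.** If $X(t,x)=\sum_{i=1}^n X^i(t,x)\,\partial/\partial x^i$ locally on $N$, then its diagonal prolongation to $N^{\ell+1}$, with points $(x_{(0)},\dots,x_{(\ell)})$, is the $t$-dependent vector field $X^{[\ell+1]}(t,x_{(0)},\dots,x_{(\ell)})=\sum_{a=0}^{\ell}\sum_{i=1}^n X^i(t,x_{(a)})\,\partial/\partial x^i_{(a)}$. *)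

(* Defs.v *)
From HB Require Import structures.
From mathcomp Require Import all_boot all_order all_algebra.
From mathcomp Require Import all_classical all_reals all_analysis.

Set Implicit Arguments.
Unset Strict Implicit.
Unset Printing Implicit Defensive.

Import Order.TTheory GRing.Theory Num.Theory.
Import numFieldNormedType.Exports.

Local Open Scope classical_set_scope.
Local Open Scope ring_scope.

(* For finite-dimensional V and open U this is being of class C^oo on U: all
   iterated directional derivatives exist and are Frechet differentiable. *)
Definition smooth_on (R : realType) (V W : normedModType R) (U : set V)
    (f : V -> W) : Prop :=
  forall (vs : seq V) (x : V), U x ->
    differentiable (foldr (fun v (g : V -> W) => 'D_v g) f vs) x.

(* A smooth, Hausdorff, connected manifold of dimension n.  The atlas is
   indexed by the points of the manifold (choosing a chart around each point
   presents any manifold in this way): the chart of index c is a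
   homeomorphism cmap c, with inverse cinv c, from an open neighbourhood
   cdom c of c onto an open subset of R^n.  The values of cmap c outside of
   cdom c, and those of cinv c outside of cmap c @` cdom c, are irrelevant. *)
Record manifold (R : realType) (n : nat) := Manifold {
  carrier :> topologicalType;
  cdom : carrier -> set carrier;
  cmap : carrier -> carrier -> 'rV[R]_n;
  cinv : carrier -> 'rV[R]_n -> carrier;
  cdom_open : forall c, open (cdom c);
  cdom_center : forall c, cdom c c;
  cmap_open : forall c, open (cmap c @` cdom c);
  cmapK : forall c x, cdom c x -> cinv c (cmap c x) = x;
  cmap_continuous : forall c, {in cdom c, continuous (cmap c)};
  cinv_continuous : forall c, {in cmap c @` cdom c, continuous (cinv c)};
  transition_smooth : forall c d,
    smooth_on (cmap c @` (cdom c `&` cdom d)) (cmap d \o cinv c);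
  manifold_hausdorff : hausdorff_space carrier;
  manifold_connected : connected [set: carrier]
}.

Section vector_fields.
Context {R : realType} {n : nat} {M : manifold R n}.
Implicit Types (X Y Z : M -> 'rV[R]_n) (c x : M) (u v w : 'rV[R]_n).

(* The tangent space at x is identified with R^n by means of the chart of
   index x, so that a not necessarily smooth vector field is a map from M
   to 'rV[R]_n.  Below are the components of X, at the point of coordinates
   u, in the chart of index c. *)
Definition vf_rep c X u : 'rV[R]_n :=
  let y := cinv c u in 'd (cmap c \o cinv y) (cmap y y) (X y).

Definition smooth_vf_on (U : set M) X : Prop :=
  forall c, smooth_on (cmap c @` (cdom c `&` U)) (vf_rep c X).

Definition smooth_vf X : Prop := smooth_vf_on setT X.

Definition smooth_tvf (X : R -> M -> 'rV[R]_n) : Prop :=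
  forall c, smooth_on (setT `*` (cmap c @` cdom c))
    (fun p : R * 'rV[R]_n => vf_rep c (X p.1) p.2).

(* [X, Y]^i = X^j d_j Y^i - Y^j d_j X^i, computed in the chart of index x. *)
Definition bracket X Y : M -> 'rV[R]_n := fun x =>
  'D_(X x) (vf_rep x Y) (cmap x x) - 'D_(Y x) (vf_rep x X) (cmap x x).

Definition Lie_algebra (V : set (M -> 'rV[R]_n)) : Prop :=
  [/\ V `<=` smooth_vf,
      V 0,
      forall (a b : R) X Y, V X -> V Y -> V (a *: X + b *: Y) &
      forall X Y, V X -> V Y -> V (bracket X Y)].

Definition Lie_system (X : R -> M -> 'rV[R]_n) : Prop :=
  smooth_tvf X /\
  exists (r : nat) (b : 'I_r -> R -> R) (Z : 'I_r -> M -> 'rV[R]_n),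
    [/\ forall a : 'I_r -> R, \sum_i a i *: Z i = 0 -> forall i, a i = 0,
        Lie_algebra [set Y | exists a : 'I_r -> R, Y = \sum_i a i *: Z i] &
        forall t, X t = \sum_i b i t *: Z i].

Definition smallest_Lie_algebra (X : R -> M -> 'rV[R]_n) :
    set (M -> 'rV[R]_n) :=
  smallest Lie_algebra (range X).

(* A regular distribution of rank r: a smooth subbundle of rank r of the
   tangent bundle, i.e. one with a smooth local frame around each point. *)
Definition regular_distribution (r : nat) (D : M -> set 'rV[R]_n) : Prop :=
  forall x, exists (U : set M) (Z : 'I_r -> M -> 'rV[R]_n),
    [/\ open_nbhs x U,
        forall i, smooth_vf_on U (Z i) &
        forall y, U y -> row_free (\matrix_(i < r) Z i y) /\
          forall v, D y v <-> (v <= \matrix_(i < r) Z i y)%MS].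

End vector_fields.

Section contact.
Context {R : realType} {n : nat} {M : manifold R n} {k : nat}.
(* An R^k-valued one-form eta: the alpha-th component of v *m eta x is the
   value of eta^alpha at the tangent vector v at x. *)
Implicit Types (eta : M -> 'M[R]_(n, k)) (c x : M) (u v w : 'rV[R]_n).

Definition form_rep c eta u v : 'rV[R]_k :=
  let y := cinv c u in ('d (cmap y \o cinv c) u v) *m eta y.

Definition smooth_form eta : Prop :=
  forall c v, smooth_on (cmap c @` cdom c) (fun u => form_rep c eta u v).

(* d eta (v, w) at x, with v and w extended as constant vector fields in the
   chart of index x. *)
Definition dform eta x v w : 'rV[R]_k :=
  'D_v (fun u => form_rep x eta u w) (cmap x x) -
  'D_w (fun u => form_rep x eta u v) (cmap x x).

Definition ker_form eta x : set 'rV[R]_n := [set v | v *m eta x = 0].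

Definition ker_dform eta x : set 'rV[R]_n :=
  [set v | forall w, dform eta x v w = 0].

Definition contact_form eta : Prop :=
  [/\ smooth_form eta,
      (exists r : nat, [/\ (r + k)%N = n, (0 < r)%N &
        regular_distribution r (ker_form eta)]),
      regular_distribution k (ker_dform eta) &
      forall x, ker_form eta x `&` ker_dform eta x = [set 0]].

Definition form_Hamiltonian eta (Y : M -> 'rV[R]_n) : Prop :=
  smooth_vf Y /\
  forall Z : M -> 'rV[R]_n, smooth_vf Z ->
    (forall x, ker_form eta x (Z x)) ->
    forall x, ker_form eta x (bracket Y Z x).

Definition contact_Lie_system eta (X : R -> M -> 'rV[R]_n) : Prop :=
  [/\ contact_form eta, Lie_system X &
      forall Y, smallest_Lie_algebra X Y -> form_Hamiltonian eta Y].

End contact.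

Definition is_contact_Lie_system (R : realType) (n : nat) (M : manifold R n)
    (k : nat) (X : R -> M -> 'rV[R]_n) : Prop :=
  exists eta : M -> 'M[R]_(n, k), contact_Lie_system eta X.

Section smooth_theory.
Context {R : realType}.
Implicit Types V W : normedModType R.

Lemma near_eq_differentiable V W (f g : V -> W) (x : V) :
  (\near x, f x = g x) -> differentiable f x -> differentiable g x.
Proof.
move=> fg df.
have fgx : f x = g x := nbhs_singleton fg.
have dc : continuous ('d f x) by exact: diff_continuous.
have E : g \o shift x = cst (g x) + 'd f x +o_ 0 id.
  apply/eqaddoP => _/posnumP[e].
  have /eqaddoP /(_ e%:num) /(_ [gt0 of e%:num]) := diff_locally df.
  apply: filter_app; near=> h.
  rewrite /= -fgx; suff -> : (g \o shift x - (cst (f x) + 'd f x)) h =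
    (f \o shift x - (cst (f x) + 'd f x)) h by [].
  rewrite /= ![(_ - _) h]/(_ h - _ h) /=; congr (_ - _); apply/esym.
  near: h.
  by move: fg; rewrite (near_shift 0 x) subr0.
apply/diff_locallyP; have -> := diff_unique dc E.
by split.
Unshelve. all: by end_near. Qed.

Lemma mx_continuous (T : topologicalType) m n (f : T -> 'M[R]_(m, n)) (x : T) :
  (forall i j, f y i j @[y --> x] --> f x i j) -> {for x, continuous f}.
Proof.
move=> fc A [P PA PAs].
have : \forall y \near x, forall i j, P i j (f y i j).
  apply: filter_forall => i; apply: filter_forall => j.
  exact: (fc i j _ (PA i j)).
by apply: filterS => y Py; apply: PAs.
Qed.

Section rows.
Variables m n : nat.
Implicit Types (u : 'rV[R]_(m * n)) (a : 'I_m).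

Definition proj_row a u : 'rV[R]_n := row a (vec_mx u).

Lemma proj_row_linear a : linear (proj_row a).
Proof. by move=> s u v; rewrite /proj_row !linearP. Qed.
HB.instance Definition _ a :=
  GRing.isLinear.Build R 'rV[R]_(m * n) 'rV[R]_n _ (proj_row a)
    (proj_row_linear a).

Lemma proj_row_continuous a : continuous (proj_row a).
Proof.
move=> u; apply: mx_continuous => i j; rewrite !mxE.
under eq_fun do rewrite !mxE.
exact: coord_continuous.
Qed.

Definition join_rows (w : 'I_m -> 'rV[R]_n) : 'rV[R]_(m * n) :=
  mxvec (\matrix_(a < m) w a).

Lemma join_rowsK w a : proj_row a (join_rows w) = w a.
Proof. by rewrite /proj_row /join_rows mxvecK rowK. Qed.

Lemma proj_rowK u : join_rows (proj_row^~ u) = u.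
Proof.
rewrite /join_rows -[RHS]vec_mxK; congr mxvec.
by apply/row_matrixP => a; rewrite rowK.
Qed.

Lemma join_rows_continuous (T : topologicalType) (f : 'I_m -> T -> 'rV[R]_n)
    (x : T) :
  (forall a, {for x, continuous (f a)}) ->
  {for x, continuous (fun y => join_rows (f^~ y))}.
Proof.
move=> fc; apply: mx_continuous => i k.
case/mxvec_indexP: k => a j; rewrite ord1 /join_rows mxvecE mxE.
under eq_fun do rewrite mxvecE mxE.
apply: (@continuous_comp _ _ _ (f a) (fun A : 'rV[R]_n => A 0 j)) => //.
exact: coord_continuous.
Qed.

Definition inj_row a (w : 'rV[R]_n) : 'rV[R]_(m * n) :=
  join_rows (fun b => if b == a then w else 0).

Lemma inj_row_linear a : linear (inj_row a).
Proof.
move=> s u v; apply: (can_inj proj_rowK); apply/funext => b.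
rewrite linearP /= !join_rowsK; case: eqP => // _.
by rewrite scaler0 addr0.
Qed.
HB.instance Definition _ a :=
  GRing.isLinear.Build R 'rV[R]_n 'rV[R]_(m * n) _ (inj_row a)
    (inj_row_linear a).

Lemma inj_row_continuous a : continuous (inj_row a).
Proof.
move=> w; apply: (@join_rows_continuous 'rV[R]_n
  (fun b v => if b == a then v else 0) w) => b.
by case: eqP => _; [exact: cvg_id | exact: (@cst_continuous _ _ (0 : 'rV[R]_n) w)].
Qed.

Lemma join_rows_sum w : join_rows w = \sum_a inj_row a (w a).
Proof.
apply: (can_inj proj_rowK); apply/funext => b.
rewrite linear_sum join_rowsK (bigD1 b) //= join_rowsK eqxx big1 ?addr0 //.
by move=> a ab; rewrite join_rowsK eq_sym (negbTE ab).
Qed.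

Lemma open_proj_row (U : 'I_m -> set 'rV[R]_n) : (forall a, open (U a)) ->
  open [set u | forall a, U a (proj_row a u)].
Proof.
move=> Uo; rewrite openE => u Uu.
suff : \forall v \near u, forall a, U a (proj_row a v) by [].
apply: (@filter_forall _ _ (fun a v => U a (proj_row a v)) _
  (nbhs_filter u)) => a.
apply: (proj_row_continuous (a := a)).
by apply: open_nbhs_nbhs; split.
Qed.

Lemma diff_join_rows (g : 'I_m -> 'rV[R]_n -> 'rV[R]_n) u :
  (forall a, differentiable (g a) (proj_row a u)) ->
  let G := fun u => join_rows (fun a => g a (proj_row a u)) in
  differentiable G u /\
  forall v, 'D_v G u =
    join_rows (fun a => 'D_(proj_row a v) (g a) (proj_row a u)).
Proof.
move=> gd G.
have dp a : differentiable (proj_row a) u.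
  by apply: linear_differentiable; exact: proj_row_continuous.
have di a w : differentiable (inj_row a) w.
  by apply: linear_differentiable; exact: inj_row_continuous.
have GE : G = \sum_a (inj_row a \o (g a \o proj_row a)).
  by apply/funext => w; rewrite /G join_rows_sum fct_sumE.
have dg a : differentiable (g a \o proj_row a) u.
  by apply: differentiable_comp.
have dig a : differentiable (inj_row a \o (g a \o proj_row a)) u.
  by apply: differentiable_comp.
split; first by rewrite GE; apply: differentiable_sum.
move=> v; rewrite GE derive_sum; last first.
  by move=> a; apply: diff_derivable.
rewrite join_rows_sum; apply: eq_bigr => a _.
rewrite deriveE // deriveE //.
rewrite (@diff_comp _ _ _ _ (g a \o proj_row a) (inj_row a)) //=.
rewrite (@diff_comp _ _ _ _ (proj_row a) (g a)) //=.
rewrite (diff_lin _ (@inj_row_continuous a)).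
by rewrite (diff_lin _ (@proj_row_continuous a)).
Qed.

Lemma smooth_join_rows (U : 'I_m -> set 'rV[R]_n)
    (f : 'I_m -> 'rV[R]_n -> 'rV[R]_n) :
  (forall a, open (U a)) -> (forall a, smooth_on (U a) (f a)) ->
  smooth_on [set u | forall a, U a (proj_row a u)]
    (fun u => join_rows (fun a => f a (proj_row a u))).
Proof.
move=> Uo fs; set P := [set u | _].
have Po : open P by exact: open_proj_row.
set F := fun u => _.
pose G vs u := join_rows (fun a =>
  foldr (fun v (g : 'rV[R]_n -> 'rV[R]_n) => 'D_v g) (f a)
    (map (proj_row a) vs) (proj_row a u)).
have Gd vs u : P u -> differentiable (G vs) u /\
    forall v, 'D_v (G vs) u = G (v :: vs) u.
  by move=> Pu; apply: diff_join_rows => a; apply: fs; apply: Pu.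
have FG vs u : P u ->
    foldr (fun v (g : 'rV[R]_(m * n) -> 'rV[R]_(m * n)) => 'D_v g) F vs u =
    G vs u.
  elim: vs u => [//|v vs IH] u Pu /=; rewrite -(Gd _ _ Pu).2.
  apply: near_eq_derive; near=> w; apply: IH; near: w.
  by apply: open_nbhs_nbhs; split.
move=> vs u Pu; apply: near_eq_differentiable (Gd vs u Pu).1.
near=> w; apply/esym/FG; near: w.
by apply: open_nbhs_nbhs; split.
Unshelve. all: by end_near. Qed.

End rows.

End smooth_theory.

Lemma connected_power (I : finType) (T : topologicalType) :
  connected [set: T] -> connected [set: {ptws I -> T}].
Proof.
move=> cT; have [[x0 _]|] := pselect ([set: {ptws I -> T}] !=set0); last first.
  by move=> /set0P/negP/negPn/eqP ->; exact: connected0.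
suff -> : [set: {ptws I -> T}] = connected_component setT x0.
  exact: component_connected.
apply/esym/seteqP; split => // y _.
pose z (s : seq I) : {ptws I -> T} := fun i => if i \in s then y i else x0 i.
have -> : y = z (enum I) by apply/funext => i; rewrite /z mem_enum.
elim: (enum I) => [|i s IH].
  by have -> : z [::] = x0 by []; exact: connected_component_refl.
apply: (connected_component_trans IH).
pose h : T -> {ptws I -> T} := @dfwith I (fun=> T) (z s) i.
exists (h @` setT); first split => //.
- exists (z s i) => //; apply/funext => j; rewrite /h.
  by case: dfwithP.
- apply: connected_continuous_connected => //.
  apply: continuous_subspaceT => w.
  exact: (@dfwith_continuous I (fun=> T) (z s) i w).
- exists (y i) => //; apply/funext => j; rewrite /h /z in_cons.
  case: dfwithP => [|j' ij]; first by rewrite eqxx.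
  by rewrite eq_sym (negbTE ij).
Qed.

(* N^(ell+1) with the product topology and the product charts; R^n x ... x R^n
   is identified with 'rV[R]_(ell.+1 * n) by concatenation. *)
Section power_manifold.
Context {R : realType} {n : nat}.
Variables (N : manifold R n) (ell : nat).

Let T : topologicalType := {ptws 'I_ell.+1 -> N}.
Definition power_dom (c : T) : set T := [set x | forall a, cdom (c a) (x a)].
Definition power_map (c x : T) : 'rV[R]_(ell.+1 * n) :=
  join_rows (fun a => cmap (c a) (x a)).
Definition power_inv (c : T) (u : 'rV[R]_(ell.+1 * n)) : T :=
  fun a => cinv (c a) (proj_row a u).

Fact power_proj_continuous (a : 'I_ell.+1) : continuous (fun x : T => x a).
Proof. exact: (@proj_continuous _ (fun=> N : topologicalType) a). Qed.

Fact power_image (c : T) (A : 'I_ell.+1 -> set N) :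
  power_map c @` [set x : T | forall a, A a (x a)] =
  [set u | forall a, (cmap (c a) @` A a) (proj_row a u)].
Proof.
apply/seteqP; split => [_ [x Ax <-] a /=|u Au].
  by rewrite join_rowsK; exists (x a).
have Au' a : exists x, A a x /\ cmap (c a) x = proj_row a u.
  by case: (Au a) => x; exists x.
have [x xP] := choice Au'.
exists x => /=; first by move=> a; case: (xP a).
by rewrite -[RHS]proj_rowK; congr join_rows; apply/funext => a; case: (xP a).
Qed.

Fact power_image_dom c : power_map c @` power_dom c =
  [set u | forall a, (cmap (c a) @` cdom (c a)) (proj_row a u)].
Proof. exact: (power_image c (fun a => cdom (c a))). Qed.

Fact power_dom_open c : open (power_dom c).
Proof.
rewrite openE => x xc.
suff : \forall y \near x, forall a, cdom (c a) (y a) by [].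
apply: (@filter_forall _ _ (fun a y => cdom (c a) (y a)) _
  (nbhs_filter x)) => a.
apply: (@power_proj_continuous a).
by apply: open_nbhs_nbhs; split; [exact: cdom_open | exact: xc].
Qed.

Fact power_dom_center c : power_dom c c.
Proof. by move=> a; exact: cdom_center. Qed.

Fact power_map_open c : open (power_map c @` power_dom c).
Proof.
rewrite power_image_dom.
apply: (open_proj_row (U := fun a => cmap (c a) @` cdom (c a))) => a.
exact: cmap_open.
Qed.

Fact power_mapK c x : power_dom c x -> power_inv c (power_map c x) = x.
Proof. by move=> cx; apply/funext => a; rewrite /power_inv join_rowsK cmapK. Qed.

Fact power_map_continuous c : {in power_dom c, continuous (power_map c)}.
Proof.
move=> x /set_mem cx.
apply: (@join_rows_continuous _ _ _ _ (fun a (y : T) => cmap (c a) (y a))) => a.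
apply: (@continuous_comp _ _ _ (fun y : T => y a)).
  exact: power_proj_continuous.
by apply: cmap_continuous; apply/mem_set/cx.
Qed.

Fact power_inv_continuous c :
  {in power_map c @` power_dom c, continuous (power_inv c)}.
Proof.
move=> u /set_mem; rewrite power_image_dom => uc.
have H a : {for u, continuous (fun v => power_inv c v a)}.
  apply: (@continuous_comp _ _ _ (proj_row a)).
    exact: proj_row_continuous.
  by apply: cinv_continuous; apply/mem_set/uc.
have FF : Filter (power_inv c x @[x --> u]).
  exact: (fmap_filter _ (nbhs_filter u)).
apply/cvg_sup => a; apply/cvg_image => [|A].
  by apply/seteqP; split => // w _; exists (fun=> w).
move=> /H Ha.
exists ((fun x : T => x a) @^-1` A) => //.
apply/seteqP; split => [_ [x Ax <-] //|w Aw].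
by exists (fun=> w).
Qed.

Fact power_transition_smooth c d :
  smooth_on (power_map c @` (power_dom c `&` power_dom d))
    (power_map d \o power_inv c).
Proof.
have -> : power_dom c `&` power_dom d =
    [set x | forall a, (cdom (c a) `&` cdom (d a)) (x a)].
  apply/seteqP; split => [x [xc xd] a //|x cd].
  by split => a; case: (cd a).
rewrite (power_image c (fun a => cdom (c a) `&` cdom (d a))).
apply: (smooth_join_rows
  (U := fun a => cmap (c a) @` (cdom (c a) `&` cdom (d a)))
  (f := fun a => cmap (d a) \o cinv (c a))) => a; last exact: transition_smooth.
have -> : cmap (c a) @` (cdom (c a) `&` cdom (d a)) =
    cmap (c a) @` cdom (c a) `&` cinv (c a) @^-1` cdom (d a).
  apply/seteqP; split => [_ [x [xc xd] <-]|_ [[x xc <-]]] /=.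
    by split; [exists x | rewrite /= cmapK].
  by rewrite cmapK // => xd; exists x.
rewrite openE => u [uc ud]; apply: filterI.
  by apply: open_nbhs_nbhs; split => //; exact: cmap_open.
apply: (cinv_continuous (mem_set uc)).
by apply: open_nbhs_nbhs; split => //; exact: cdom_open.
Qed.

Fact power_hausdorff : hausdorff_space T.
Proof.
exact: (@hausdorff_product _ (fun=> N : topologicalType)
  (fun=> @manifold_hausdorff _ _ N)).
Qed.

Fact power_connected : connected [set: T].
Proof. by apply: connected_power; exact: manifold_connected. Qed.

Definition power_manifold : manifold R (ell.+1 * n) :=
  Manifold power_dom_open power_dom_center power_map_open power_mapK
    power_map_continuous power_inv_continuous power_transition_smooth
    power_hausdorff power_connected.

(* In the product chart the components of the prolongation at
   (x_0, ..., x_ell) are those of X t at x_0, ..., x_ell. *)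
Definition prolongation (X : R -> N -> 'rV[R]_n) :
    R -> power_manifold -> 'rV[R]_(ell.+1 * n) :=
  fun t x => join_rows (fun a => X t (x a)).

End power_manifold.

Arguments prolongation {R n N} ell X t x.

(* Main.v *)
Require Import Defs.
From HB Require Import structures.
From mathcomp Require Import all_boot all_order all_algebra.
From mathcomp Require Import all_classical all_reals all_analysis.

(* On N^(l+1) take the direct sum of the pullbacks of eta along the l+1
   projections.  Its kernel and that of its differential are the direct sums of
   the kernels on the factors, so it is a k(l+1)-contact form.  Diagonal
   prolongation is an injective morphism of Lie algebras; hence it preserves Lie
   systems, and V^(X^[l+1]) consists of prolongations of elements of V^X.  Let
   Y be eta-Hamiltonian and let Z, on N^(l+1), take values in the kernel.  When
   only the a-th point moves, Z_a is a vector field on N with values in ker eta,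
   which the bracket with Y preserves; when only the other points move, Z_a
   stays in a fixed fibre of ker eta, and so do its derivatives.  Adding the two
   contributions, [Y^[l+1], Z] takes values in the kernel. *)

Set Implicit Arguments.
Unset Strict Implicit.
Unset Printing Implicit Defensive.

Import Order.TTheory GRing.Theory Num.Theory.
Import numFieldNormedType.Exports.

Local Open Scope classical_set_scope.
Local Open Scope ring_scope.

(** * Smooth maps between normed modules *)

Section smooth_maps.
Context {R : realType}.
Implicit Types V W : normedModType R.

(** Since [U] is open, the equality holds near each point of [U] and so passes to all iterated
    derivatives. This allows a chart expression to be replaced by a formula valid only inside the
    chart. *)
Lemma smooth_on_eq V W (U : set V) (f g : V -> W) :
  open U -> (forall u, U u -> f u = g u) -> smooth_on U f -> smooth_on U g.
Proof.
move=> Uo fg fs vs x Ux.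
have E : forall u, U u -> foldr (fun v (g : V -> W) => 'D_v g) f vs u =
    foldr (fun v (g : V -> W) => 'D_v g) g vs u.
  elim: vs => [//|v vs IH] u Uu /=.
  apply: near_eq_derive; near=> w; apply: IH; near: w.
  by apply: open_nbhs_nbhs; split.
apply: near_eq_differentiable (fs vs x Ux).
near=> w; apply: E; near: w.
by apply: open_nbhs_nbhs; split.
Unshelve. all: by end_near. Qed.

Lemma smooth_on_sub V W (U U' : set V) (f : V -> W) :
  U `<=` U' -> smooth_on U' f -> smooth_on U f.
Proof. by move=> UU fs vs x /UU; exact: fs. Qed.

Lemma derive_comp_affine V V' W (L : {linear V -> V'}) (p : V') (f : V' -> W)
    (u v : V) : 'D_v (fun u => f (p + L u)) u = 'D_(L v) f (p + L u).
Proof.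
rewrite /derive; congr (lim _).
suff -> : (fun h : R => h^-1 *: (((fun u => f (p + L u)) \o shift u) (h *: v) -
    f (p + L u))) =
  (fun h : R => h^-1 *: ((f \o shift (p + L u)) (h *: L v) - f (p + L u))) by [].
apply/funext => h /=; congr (_ *: (f _ - _)).
by rewrite linearD linearZ addrCA.
Qed.

Lemma differentiable_affine V V' (L : {linear V -> V'}) (p : V') (u : V) :
  continuous L -> differentiable (fun u => p + L u) u.
Proof.
move=> Lc; apply: differentiableD; first exact: differentiable_cst.
exact: linear_differentiable.
Qed.

(** The derivative of an affine map is constant, so each iterated derivative of the composite is an
    iterated derivative of [f], along the images [map L vs], composed with the same affine map. *)
Lemma smooth_on_comp_affine V V' W (L : {linear V -> V'}) (p : V')
    (U : set V') (f : V' -> W) :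
  continuous L -> smooth_on U f ->
  smooth_on [set u | U (p + L u)] (fun u => f (p + L u)).
Proof.
move=> Lc fs vs x Ux.
have -> : foldr (fun v (g : V -> W) => 'D_v g) (fun u => f (p + L u)) vs =
    foldr (fun v (g : V' -> W) => 'D_v g) f (map L vs) \o (fun u => p + L u).
  elim: vs => [//|v vs IH] /=; rewrite IH.
  by apply/funext => u; exact: derive_comp_affine.
apply: differentiable_comp; first exact: differentiable_affine.
exact: fs.
Qed.

Lemma derive_linear V W W' (L : {linear W -> W'}) (f : V -> W) (u v : V) :
  continuous L -> differentiable f u ->
  differentiable (L \o f) u /\ 'D_v (L \o f) u = L ('D_v f u).
Proof.
move=> Lc fd; have dL w : differentiable L w by exact: linear_differentiable.
have dLf : differentiable (L \o f) u by exact: differentiable_comp.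
split=> //; rewrite !deriveE // diff_comp //=.
by rewrite (diff_lin _ Lc).
Qed.

Lemma smooth_on_linear V W W' (L : {linear W -> W'}) (U : set V) (f : V -> W) :
  open U -> continuous L -> smooth_on U f -> smooth_on U (L \o f).
Proof.
move=> Uo Lc fs vs x Ux.
have E : forall u, U u -> (L \o foldr (fun v (g : V -> W) => 'D_v g) f vs) u =
    foldr (fun v (g : V -> W') => 'D_v g) (L \o f) vs u.
  elim: vs => [//|v vs IH] u Uu /=.
  rewrite -(derive_linear v Lc (fs vs u Uu)).2.
  apply: near_eq_derive; near=> w; apply: IH; near: w.
  by apply: open_nbhs_nbhs; split.
apply: (@near_eq_differentiable _ _ _
  (L \o foldr (fun v (g : V -> W) => 'D_v g) f vs)).
  near=> w; apply: E; near: w.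
  by apply: open_nbhs_nbhs; split.
exact: (derive_linear 0 Lc (fs vs x Ux)).1.
Unshelve. all: by end_near. Qed.

Lemma smooth_on_sum V W (U : set V) m (f : 'I_m -> V -> W) :
  open U -> (forall i, smooth_on U (f i)) -> smooth_on U (\sum_i f i).
Proof.
move=> Uo fs vs x Ux.
have E : forall u, U u ->
    (\sum_i foldr (fun v (g : V -> W) => 'D_v g) (f i) vs) u =
    foldr (fun v (g : V -> W) => 'D_v g) (\sum_i f i) vs u.
  elim: vs => [//|v vs IH] u Uu /=.
  have -> : 'D_v (foldr (fun v (g : V -> W) => 'D_v g) (\sum_i f i) vs) u =
    'D_v (\sum_i foldr (fun v (g : V -> W) => 'D_v g) (f i) vs) u.
    apply: near_eq_derive; near=> w; apply/esym/IH; near: w.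
    by apply: open_nbhs_nbhs; split.
  rewrite derive_sum ?fct_sumE // => i.
  exact/diff_derivable/fs.
apply: (@near_eq_differentiable _ _ _
  (\sum_i foldr (fun v (g : V -> W) => 'D_v g) (f i) vs)).
  near=> w; apply: E; near: w.
  by apply: open_nbhs_nbhs; split.
by apply: differentiable_sum => i; exact: fs.
Unshelve. all: by end_near. Qed.

(** As a sum of continuous linear injections applied to the components, a joined map obeys the rules
    already established for linear maps and sums. *)
Lemma join_rows_fctE V m k (f : 'I_m -> V -> 'rV[R]_k) :
  (fun u => join_rows (f^~ u)) = \sum_a (inj_row a \o f a).
Proof. by apply/funext => u; rewrite join_rows_sum fct_sumE. Qed.

Lemma smooth_on_join_rows V m k (U : set V) (f : 'I_m -> V -> 'rV[R]_k) :
  open U -> (forall a, smooth_on U (f a)) ->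
  smooth_on U (fun u => join_rows (f^~ u)).
Proof.
move=> Uo fs; rewrite join_rows_fctE; apply: smooth_on_sum => // a.
by apply: smooth_on_linear => //; exact: inj_row_continuous.
Qed.

Lemma derive_join_rows V m k (f : 'I_m -> V -> 'rV[R]_k) u v :
  (forall a, differentiable (f a) u) ->
  'D_v (fun u => join_rows (f^~ u)) u = join_rows (fun a => 'D_v (f a) u).
Proof.
move=> fd; have ic := @inj_row_continuous R m k.
rewrite join_rows_fctE derive_sum => [|a].
  rewrite join_rows_sum; apply: eq_bigr => a _.
  exact: (derive_linear v (ic a) (fd a)).2.
exact/diff_derivable/(derive_linear 0 (ic a) (fd a)).1.
Qed.

Lemma derive_proj_row m n W (f : 'rV[R]_n -> W) (a : 'I_m) u v :
  'D_v (fun u => f (proj_row a u)) u = 'D_(proj_row a v) f (proj_row a u).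
Proof.
have := derive_comp_affine
  (proj_row a : {linear 'rV[R]_(m * n) -> 'rV[R]_n}) 0 f u v.
rewrite add0r => <-; congr ('D_v _ u).
by apply/funext => w; rewrite add0r.
Qed.

Lemma differentiable_proj_row m n W (f : 'rV[R]_n -> W) (a : 'I_m) u :
  differentiable f (proj_row a u) ->
  differentiable (fun u => f (proj_row a u)) u.
Proof.
move=> fd; apply: (@differentiable_comp _ _ _ _ (proj_row a) f) => //.
exact/linear_differentiable/proj_row_continuous.
Qed.

Lemma smooth_on_proj_row m n W (U : set 'rV[R]_n) (f : 'rV[R]_n -> W)
    (a : 'I_m) :
  smooth_on U f ->
  smooth_on [set u | U (proj_row a u)] (fun u => f (proj_row a u)).
Proof.
move=> fs.
have := smooth_on_comp_affine (L := proj_row a) (p := 0)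
  (@proj_row_continuous R m n a) fs.
by congr smooth_on; apply/funext => u /=; rewrite add0r.
Qed.

Lemma smooth_on_differentiable V W (U : set V) (f : V -> W) x :
  smooth_on U f -> U x -> differentiable f x.
Proof. by move=> fs; exact: (fs [::]). Qed.

(** The directional derivative sees [f] only on the line through [u] along [v], where all small
    difference quotients vanish. *)
Lemma derive_line0 V W (f : V -> W) u v :
  (\forall h \near (0 : R)^', f (h *: v + u) = 0) -> f u = 0 -> 'D_v f u = 0.
Proof.
move=> f0 fu; rewrite /derive; apply: lim_near_cst => //.
by near=> h; rewrite /= fu (near f0 h) // subr0 scaler0.
Unshelve. all: by end_near. Qed.

Lemma mulmxr_continuous n k (A : 'M[R]_(n, k)) :
  continuous (mulmxr A : 'rV[R]_n -> 'rV[R]_k).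
Proof.
rewrite (_ : mulmxr A = fun u : 'rV[R]_n => \sum_i u 0 i *: row i A).
  apply: continuous_big => [|i _ u]; first exact: add_continuous.
  apply: cvgZr_tmp; first exact: nbhs_filter.
  exact: (@coord_continuous R 1 n 0 i u).
by apply/funext => u; rewrite /mulmxr mulmx_sum_row.
Qed.

End smooth_maps.

(** * Block diagonal matrices *)

Section block_diagonal.
Context {R : realType} {m p q : nat}.
Implicit Types (A : 'I_m -> 'M[R]_(p, q)) (v : 'rV[R]_(m * p)).

(** Vectors are cut into rows through [vec_mx], so the blocks are placed by the matrices of
    [proj_row a] and [inj_row a] instead of explicit indices. *)
Definition block_diag A : 'M[R]_(m * p, m * q) :=
  \sum_a lin1_mx (proj_row a) *m A a *m lin1_mx (inj_row a).

Lemma mul_block_diag A v :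
  v *m block_diag A = join_rows (fun a => proj_row a v *m A a).
Proof.
rewrite mulmx_sumr join_rows_sum; apply: eq_bigr => a _.
by rewrite !mulmxA !mul_rV_lin1.
Qed.

Lemma eq_join_rows k (w w' : 'I_m -> 'rV[R]_k) :
  (forall a, w a = w' a) -> join_rows w = join_rows w'.
Proof. by move=> ww'; congr join_rows; apply/funext. Qed.

Lemma join_rowsB k (w w' : 'I_m -> 'rV[R]_k) :
  join_rows w - join_rows w' = join_rows (fun a => w a - w' a).
Proof.
apply: (can_inj (@proj_rowK R m k)); apply/funext => a.
by rewrite linearB /= !join_rowsK.
Qed.

Lemma join_rows0 k (w : 'I_m -> 'rV[R]_k) :
  join_rows w = 0 <-> forall a, w a = 0.
Proof.
split=> [w0 a|w0]; first by rewrite -(join_rowsK w a) w0 linear0.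
by rewrite join_rows_sum big1 // => a _; rewrite w0 linear0.
Qed.

Lemma mul_block_diag_eq0 A v :
  v *m block_diag A = 0 <-> forall a, proj_row a v *m A a = 0.
Proof. by rewrite mul_block_diag join_rows0. Qed.

Lemma row_free_block_diag A :
  (forall a, row_free (A a)) -> row_free (block_diag A).
Proof.
move=> Af; apply: inj_row_free => v /mul_block_diag_eq0 vA.
rewrite -(proj_rowK v); apply/join_rows0 => a.
by apply: (row_free_inj (Af a)); rewrite vA mul0mx.
Qed.

Lemma submx_block_diag A (v : 'rV[R]_(m * q)) :
  (v <= block_diag A)%MS <-> forall a, (proj_row a v <= A a)%MS.
Proof.
split=> [/submxP[D ->] a|].
  by rewrite mul_block_diag join_rowsK submxMl.
move=> vA; have /choice[D vD] : forall a, exists D, proj_row a v = D *m A a.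
  by move=> a; exact/submxP/vA.
rewrite -(proj_rowK v).
rewrite (_ : join_rows _ = join_rows D *m block_diag A) ?submxMl //.
by rewrite mul_block_diag; apply: eq_join_rows => a; rewrite vD join_rowsK.
Qed.

End block_diagonal.

(** * Charts and vector fields *)

Section manifold_lemmas.
Context {R : realType} {n : nat} {M : manifold R n}.
Implicit Types (c d x : M).

(** Inside the chart, the image is the preimage of [U] under [cinv c], which is continuous there. *)
Lemma chart_image_open c (U : set M) :
  open U -> open (cmap c @` (cdom c `&` U)).
Proof.
move=> Uo; have -> : cmap c @` (cdom c `&` U) =
    cmap c @` cdom c `&` cinv c @^-1` U.
  apply/seteqP; split => [_ [x [xc xU] <-]|_ [[x xc <-]]] /=.
    by split; [exists x | rewrite /= cmapK].
  by rewrite cmapK // => xU; exists x.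
rewrite openE => u [uc uU]; apply: filterI.
  by apply: open_nbhs_nbhs; split => //; exact: cmap_open.
apply: (cinv_continuous (mem_set uc)).
by apply: open_nbhs_nbhs; split.
Qed.

Lemma chart_imageT c : cmap c @` (cdom c `&` setT) = cmap c @` cdom c.
Proof. by rewrite setIT. Qed.

Lemma chart_inv c u : (cmap c @` cdom c) u -> cdom c (cinv c u).
Proof. by case=> x xc <-; rewrite cmapK. Qed.

Lemma chart_invK c u : (cmap c @` cdom c) u -> cmap c (cinv c u) = u.
Proof. by case=> x xc <-; rewrite cmapK. Qed.

Lemma chart_center c : (cmap c @` cdom c) (cmap c c).
Proof. by exists c => //; exact: cdom_center. Qed.

Lemma near_chart c u : (cmap c @` cdom c) u -> \near u, (cmap c @` cdom c) u.
Proof. by move=> uc; apply: open_nbhs_nbhs; split => //; exact: cmap_open. Qed.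

Lemma transition_differentiable c d u :
  (cmap c @` (cdom c `&` cdom d)) u -> differentiable (cmap d \o cinv c) u.
Proof. exact/smooth_on_differentiable/transition_smooth. Qed.

(** The transition from a chart to itself is known to be the identity only on the chart image; this
    set is open, so it determines the differential at [u]. *)
Lemma diff_transition_id c u v :
  (cmap c @` cdom c) u -> 'd (cmap c \o cinv c) u v = v.
Proof.
move=> uc; rewrite -deriveE; last first.
  by apply: transition_differentiable; rewrite setIid.
have E : \near u, (cmap c \o cinv c) u = id u.
  by near=> w; apply: chart_invK; near: w; exact: near_chart.
rewrite (near_eq_derive v E).
exact: derive_id.
Unshelve. all: by end_near. Qed.

Lemma vf_repE c (Z : M -> 'rV[R]_n) u : vf_rep c Z u =
  'd (cmap c \o cinv (cinv c u)) (cmap (cinv c u) (cinv c u)) (Z (cinv c u)).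
Proof. by []. Qed.

Lemma smooth_vf_on_sum (U : set M) r (a : 'I_r -> R)
    (Z : 'I_r -> M -> 'rV[R]_n) :
  open U -> (forall i, smooth_vf_on U (Z i)) ->
  smooth_vf_on U (fun x => \sum_i a i *: Z i x).
Proof.
move=> Uo Zs c.
have E : vf_rep c (fun x => \sum_i a i *: Z i x) =
    \sum_i (a i \*: vf_rep c (Z i)).
  apply/funext => u; rewrite (fct_sumE (I := 'I_r)) vf_repE.
  rewrite
    (linear_sum ('d (cmap c \o cinv (cinv c u)) (cmap (cinv c u) (cinv c u)))).
  apply: eq_bigr => i _.
  by rewrite linearZ.
rewrite E.
have Io := @chart_image_open c U Uo.
apply: smooth_on_sum => // i.
apply: (@smooth_on_linear _ _ _ _ ( *:%R (a i) : {linear _ -> _})) => //.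
  exact: scaler_continuous.
exact: Zs.
Qed.

Lemma vf_rep_differentiable c (Z : M -> 'rV[R]_n) u :
  smooth_vf Z -> (cmap c @` cdom c) u -> differentiable (vf_rep c Z) u.
Proof.
by move=> Zs uc; apply: smooth_on_differentiable (Zs c) _; rewrite chart_imageT.
Qed.

(** Closure under combinations and brackets passes to intersections. The ambient [V] is one of the
    sets intersected, which makes every element smooth. *)
Lemma Lie_algebra_smallest (V G : set (M -> 'rV[R]_n)) :
  Lie_algebra V -> G `<=` V -> Lie_algebra (smallest Lie_algebra G).
Proof.
move=> VL GV; split.
- by move=> Y /(_ V (conj VL GV)); case: VL => + _ _ _; exact.
- by move=> W [[]].
- move=> a b Y Z YG ZG W WG; case: (WG) => -[_ _ + _] _.
  by apply; [exact: YG | exact: ZG].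
- move=> Y Z YG ZG W WG; case: (WG) => -[_ _ _ +] _.
  by apply; [exact: YG | exact: ZG].
Qed.

End manifold_lemmas.

(** * Vector fields on a power of a manifold *)

Section power.
Context {R : realType} {n : nat} {N : manifold R n} {ell : nat}.
Local Notation P := (power_manifold N ell).
Local Notation m := ell.+1.
Implicit Types (c d x : P) (a b : 'I_ell.+1).

Lemma power_chart_image c (U : 'I_ell.+1 -> set N) :
  cmap c @` (cdom c `&` [set x | forall a, U a (x a)]) =
  [set u | forall a, (cmap (c a) @` (cdom (c a) `&` U a)) (proj_row a u)].
Proof.
rewrite -(power_image (N := N) c (fun a => cdom (c a) `&` U a)).
congr (_ @` _); apply/seteqP; split => [x [xc xU] a|x xcU].
  by split; [exact: xc | exact: xU].
have xc : power_dom c x by move=> a; case: (xcU a).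
by split=> // a; case: (xcU a).
Qed.

Lemma power_chart_dom c u : (cmap c @` cdom c) u <->
  forall a, (cmap (c a) @` cdom (c a)) (proj_row a u).
Proof. by rewrite (power_image_dom (N := N) c). Qed.

Lemma power_map_proj c x a : proj_row a (cmap c x) = cmap (c a) (x a).
Proof. exact: join_rowsK. Qed.

Lemma diff_power_transition c d u v : (cmap c @` (cdom c `&` cdom d)) u ->
  'd (cmap d \o cinv c) u v =
  join_rows (fun a =>
    'd (cmap (d a) \o cinv (c a)) (proj_row a u) (proj_row a v)).
Proof.
move=> ucd.
have fd a : differentiable (cmap (d a) \o cinv (c a)) (proj_row a u).
  apply: transition_differentiable.
  by have := ucd; rewrite (power_chart_image c (fun a => cdom (d a))); exact.
rewrite -deriveE; last exact: transition_differentiable.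
rewrite (diff_join_rows fd).2; apply: eq_join_rows => a.
by rewrite deriveE.
Qed.

(** The tangent space of the power at [y] is read in the product of the charts of index [y a], so
    the change of charts differentiates row by row. *)
Lemma vf_rep_power c (Z : P -> 'rV[R]_(m * n)) u : (cmap c @` cdom c) u ->
  vf_rep c Z u = join_rows (fun a =>
    'd (cmap (c a) \o cinv (cinv c u a)) (cmap (cinv c u a) (cinv c u a))
      (proj_row a (Z (cinv c u)))).
Proof.
move=> uc; rewrite vf_repE diff_power_transition; last first.
  exists (cinv c u) => //; split; first exact: cdom_center.
  exact: chart_inv.
apply: eq_join_rows => a.
by rewrite (power_map_proj (cinv c u) (cinv c u) a).
Qed.

(** Each factor may carry its own field: a constant [W] gives the diagonal prolongation, whereas
    local frames on the power use different fields on different factors. *)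
Definition power_vf (W : 'I_ell.+1 -> N -> 'rV[R]_n) : P -> 'rV[R]_(m * n) :=
  fun x => join_rows (fun a => W a (x a)).

Lemma vf_rep_power_vf c W u : (cmap c @` cdom c) u ->
  vf_rep c (power_vf W) u =
  join_rows (fun a => vf_rep (c a) (W a) (proj_row a u)).
Proof.
move=> uc; rewrite vf_rep_power //; apply: eq_join_rows => a.
by rewrite join_rowsK.
Qed.

Lemma smooth_power_vf (U : 'I_ell.+1 -> set N) W :
  (forall a, open (U a)) -> (forall a, smooth_vf_on (U a) (W a)) ->
  smooth_vf_on [set x : P | forall a, U a (x a)] (power_vf W).
Proof.
move=> Uo Ws c; set Q := (X in smooth_on X).
have Qo : open Q.
  rewrite /Q power_chart_image.
  apply: (open_proj_row (U := fun a =>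
    cmap (c a) @` (cdom (c a) `&` U a))) => a.
  exact: chart_image_open.
apply: (@smooth_on_eq _ _ _ _
  (fun u => join_rows (fun a => vf_rep (c a) (W a) (proj_row a u)))) => //.
  by move=> u [x [xc _] xu]; rewrite vf_rep_power_vf //; exists x.
apply: (@smooth_on_join_rows _ _ _ _ _
  (fun a u => vf_rep (c a) (W a) (proj_row a u))) => // a.
apply: smooth_on_sub (smooth_on_proj_row (a := a) (Ws a (c a))).
by rewrite /Q power_chart_image => u; exact.
Qed.

Lemma smooth_power_vfT W :
  (forall a, smooth_vf (W a)) -> smooth_vf (power_vf W).
Proof.
move=> Ws; rewrite /smooth_vf.
have -> : setT = [set x : P | forall a, setT (x a)] by apply/seteqP; split.
by apply: (smooth_power_vf (U := fun=> setT)) => // a; exact: openT.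
Qed.

(** In a product chart the [a]-th row of the field depends on the [a]-th point only, so its
    derivative sees only the [a]-th row of the direction. *)
Lemma derive_power_vf W x (v : 'rV[R]_(m * n)) : (forall a, smooth_vf (W a)) ->
  'D_v (vf_rep x (power_vf W)) (cmap x x) =
  join_rows (fun a =>
    'D_(proj_row a v) (vf_rep (x a) (W a)) (cmap (x a) (x a))).
Proof.
move=> Ws.
have E : \forall u \near cmap x x, vf_rep x (power_vf W) u =
    join_rows (fun a => vf_rep (x a) (W a) (proj_row a u)).
  by apply: filterS (near_chart (chart_center x)) => u; exact: vf_rep_power_vf.
rewrite (near_eq_derive v E).
rewrite (derive_join_rows (f := fun a u => vf_rep (x a) (W a) (proj_row a u))).
  apply: eq_join_rows => a.
  by rewrite derive_proj_row power_map_proj.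
move=> a; apply: differentiable_proj_row; rewrite power_map_proj.
by apply: vf_rep_differentiable => //; exact: chart_center.
Qed.

Lemma bracket_power_vf W W' : (forall a, smooth_vf (W a)) ->
  (forall a, smooth_vf (W' a)) ->
  bracket (power_vf W) (power_vf W') = power_vf (fun a => bracket (W a) (W' a)).
Proof.
move=> Ws Ws'; apply/funext => x.
rewrite /bracket !derive_power_vf // join_rowsB; apply: eq_join_rows => a.
by rewrite !join_rowsK.
Qed.

End power.

(** * Contact forms on a power of a manifold *)

Section power_form.
Context {R : realType} {n k : nat} {N : manifold R n} {ell : nat}.
Local Notation P := (power_manifold N ell).
Local Notation m := ell.+1.
Implicit Types (eta : N -> 'M[R]_(n, k)) (c d x : P) (a b : 'I_ell.+1).

(** Forms act by right multiplication on row vectors, so the direct sum of the pullbacks of [eta] is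
    block diagonal. *)
Definition power_form eta : P -> 'M[R]_(m * n, m * k) :=
  fun x => block_diag (fun a => eta (x a)).

Lemma ker_power_form eta x v :
  ker_form (power_form eta) x v <-> forall a, ker_form eta (x a) (proj_row a v).
Proof. exact: mul_block_diag_eq0. Qed.

Lemma form_rep_power eta c u v : (cmap c @` cdom c) u ->
  form_rep c (power_form eta) u v =
  join_rows (fun a => form_rep (c a) eta (proj_row a u) (proj_row a v)).
Proof.
move=> uc; rewrite {1}/form_rep diff_power_transition.
  rewrite mul_block_diag; apply: eq_join_rows => a.
  by rewrite join_rowsK.
exists (cinv c u); last exact: chart_invK.
by split; [exact: chart_inv | exact: cdom_center].
Qed.

Lemma smooth_power_form eta : smooth_form eta -> smooth_form (power_form eta).
Proof.
move=> es c v; have co : open (cmap c @` cdom c) by exact: cmap_open.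
apply: (@smooth_on_eq _ _ _ _ (fun u => join_rows (fun a =>
  form_rep (c a) eta (proj_row a u) (proj_row a v)))) => //.
  by move=> u uc; rewrite form_rep_power.
apply: (@smooth_on_join_rows _ _ _ _ _
  (fun a u => form_rep (c a) eta (proj_row a u) (proj_row a v))) => // a.
apply: smooth_on_sub (smooth_on_proj_row (a := a) (es (c a) (proj_row a v))).
by move=> u /power_chart_dom; exact.
Qed.

Lemma derive_power_form eta x v w : smooth_form eta ->
  'D_v (fun u => form_rep x (power_form eta) u w) (cmap x x) =
  join_rows (fun a => 'D_(proj_row a v)
    (fun u => form_rep (x a) eta u (proj_row a w)) (cmap (x a) (x a))).
Proof.
move=> es.
have E : \forall u \near cmap x x, form_rep x (power_form eta) u w =
    join_rows (fun a => form_rep (x a) eta (proj_row a u) (proj_row a w)).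
  by apply: filterS (near_chart (chart_center x)) => u; exact: form_rep_power.
rewrite (near_eq_derive v E).
rewrite (derive_join_rows
  (f := fun a u => form_rep (x a) eta (proj_row a u) (proj_row a w))).
  apply: eq_join_rows => a.
  rewrite (derive_proj_row (fun u => form_rep (x a) eta u (proj_row a w))).
  by rewrite power_map_proj.
move=> a.
apply: (differentiable_proj_row
  (f := fun u => form_rep (x a) eta u (proj_row a w))).
rewrite power_map_proj.
by apply: smooth_on_differentiable (es (x a) _) _; exact: chart_center.
Qed.

Lemma dform_power eta x v w : smooth_form eta ->
  dform (power_form eta) x v w =
  join_rows (fun a => dform eta (x a) (proj_row a v) (proj_row a w)).
Proof. by move=> es; rewrite /dform !derive_power_form // join_rowsB. Qed.

Lemma ker_power_dform eta x v : smooth_form eta ->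
  ker_dform (power_form eta) x v <->
  forall a, ker_dform eta (x a) (proj_row a v).
Proof.
move=> es; split=> [vk a w|vk w].
  (* Testing against vectors supported in the [a]-th factor isolates the condition on that
     factor. *)
  have := vk (inj_row a w); rewrite dform_power //.
  by move/join_rows0/(_ a); rewrite join_rowsK eqxx.
by rewrite dform_power //; apply/join_rows0 => a; exact: vk.
Qed.

(** The frame consists of the fields of a local frame of each factor, extended by zero to the other
    factors. Its matrix is block diagonal, which gives both independence and span. *)
Lemma regular_distribution_power r (D : N -> set 'rV[R]_n)
    (D' : P -> set 'rV[R]_(m * n)) :
  (forall x v, D' x v <-> forall a, D (x a) (proj_row a v)) ->
  regular_distribution r D -> regular_distribution (m * r) D'.
Proof.
move=> DD' Dr x.
have /choice[U /choice[Z UZ]] := fun a : 'I_m => Dr (x a).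
pose A a z := \matrix_(j < r) Z a j z.
(* The [a]-th row of the [i]-th standard basis vector: zero unless the [i]-th field belongs to the
   factor [a], in which case it selects one field of the frame [Z a]. *)
pose e a (i : 'I_(m * r)) : 'rV[R]_r := proj_row a (delta_mx 0 i).
exists [set y : P | forall a, U a (y a)].
exists (fun i => power_vf (fun a z => \sum_j e a i 0 j *: Z a j z)).
have ZE (y : P) :
    \matrix_i power_vf (fun a z => \sum_j e a i 0 j *: Z a j z) y =
    block_diag (fun a => A a (y a)).
  apply/row_matrixP => i; rewrite rowK rowE mul_block_diag.
  apply: eq_join_rows => a; rewrite mulmx_sum_row.
  by apply: eq_bigr => j _; rewrite rowK.
split.
- split; last by move=> a; case: (UZ a) => -[].
  rewrite openE => y Uy.
  suff : \forall z \near y, forall a, U a (z a) by [].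
  apply: (@filter_forall _ _ (fun a z => U a (z a)) _ (nbhs_filter y)) => a.
  apply: (power_proj_continuous (N := N) (a := a)).
  by apply: open_nbhs_nbhs; split; [case: (UZ a) => -[] | exact: Uy].
- move=> i; apply: smooth_power_vf => a; first by case: (UZ a) => -[].
  by case: (UZ a) => -[Uo _] Zs _; exact: smooth_vf_on_sum.
- move=> y Uy; rewrite ZE; split.
    by apply: row_free_block_diag => a; case: (UZ a) => _ _ /(_ _ (Uy a))[].
  move=> v; rewrite DD' submx_block_diag.
  by split=> H a;
    case: (UZ a) => _ _ /(_ _ (Uy a))[_ /(_ (proj_row a v))[]]; auto.
Qed.

Lemma contact_power_form eta :
  contact_form eta -> contact_form (power_form eta).
Proof.
case=> es [r [rk r0 kr] kdr ek]; split.
- exact: smooth_power_form.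
- exists (m * r)%N; split; first by rewrite -mulnDr rk.
    by rewrite muln_gt0.
  apply: regular_distribution_power kr => x v; exact: ker_power_form.
- by apply: regular_distribution_power kdr => x v; exact: ker_power_dform.
- move=> x; apply/seteqP; split => v.
    case=> /ker_power_form v1 /(ker_power_dform _ _ es) v2.
    rewrite -(proj_rowK v); apply/join_rows0 => a.
    have : (ker_form eta (x a) `&` ker_dform eta (x a)) (proj_row a v) by split.
    by rewrite ek.
  move=> ->; split; first exact: mul0mx.
  apply/ker_power_dform => // a; rewrite linear0.
  (* That 0 lies in [ker_dform] is read off from [ek]. *)
  have : (ker_form eta (x a) `&` ker_dform eta (x a)) 0 by rewrite ek.
  by case.
Qed.

End power_form.

(** * Hamiltonian vector fields on a power of a manifold *)

Section Hamiltonian.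
Context {R : realType} {n k : nat} {N : manifold R n} {ell : nat}.
Local Notation P := (power_manifold N ell).
Local Notation m := ell.+1.
Implicit Types (eta : N -> 'M[R]_(n, k)) (c d x : P) (a b : 'I_ell.+1).
Implicit Types (Z : P -> 'rV[R]_(m * n)).

Definition replace x a (z : N) : P := fun b => if b == a then z else x b.

Lemma replaceE x a z : replace x a z a = z.
Proof. by rewrite /replace eqxx. Qed.

Lemma replace_id x a : replace x a (x a) = x.
Proof. by apply/funext => b; rewrite /replace; case: eqP => // ->. Qed.

Definition slice x a Z : N -> 'rV[R]_n :=
  fun z => proj_row a (Z (replace x a z)).

(** With the [a]-th row of the coordinates of [x] cleared, the affine map sending [w] to
    [slice_base x a + inj_row a w] is the coordinate expression of [replace x a]. *)
Definition slice_base x a : 'rV[R]_(m * n) :=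
  join_rows (fun b => if b == a then 0 else cmap (x b) (x b)).

Lemma proj_slice x a b w : proj_row b (slice_base x a + inj_row a w) =
  if b == a then w else cmap (x b) (x b).
Proof.
by rewrite linearD /= !join_rowsK; case: eqP => _; rewrite ?add0r ?addr0.
Qed.

Lemma slice_chart x a (c : N) w : (cmap c @` cdom c) w ->
  (cmap (replace x a c) @` cdom (replace x a c)) (slice_base x a + inj_row a w).
Proof.
move=> wc; apply/power_chart_dom => b; rewrite proj_slice /replace.
by case: eqP => // _; exact: chart_center.
Qed.

Lemma slice_inv x a (c : N) w :
  cinv (replace x a c) (slice_base x a + inj_row a w) = replace x a (cinv c w).
Proof.
apply/funext => b; rewrite /= /power_inv proj_slice /replace.
by case: eqP => // _; rewrite cmapK //; exact: cdom_center.
Qed.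

Lemma vf_rep_slice x a (c : N) Z w : (cmap c @` cdom c) w ->
  proj_row a (vf_rep (replace x a c) Z (slice_base x a + inj_row a w)) =
  vf_rep c (slice x a Z) w.
Proof.
move=> wc; rewrite vf_rep_power; last exact: slice_chart.
by rewrite join_rowsK slice_inv !replaceE.
Qed.

Lemma smooth_slice x a Z : smooth_vf Z -> smooth_vf (slice x a Z).
Proof.
move=> Zs c; rewrite chart_imageT.
have co : open (cmap c @` cdom c) by exact: cmap_open.
apply: (@smooth_on_eq _ _ _ _ (proj_row a \o
  (fun w => vf_rep (replace x a c) Z (slice_base x a + inj_row a w)))) => //.
  by move=> w wc; exact: vf_rep_slice.
apply: smooth_on_linear => //; first exact: proj_row_continuous.
have := smooth_on_comp_affine (L := inj_row a) (p := slice_base x a)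
  (@inj_row_continuous R m n a) (Zs (replace x a c)).
apply: smooth_on_sub => w /(slice_chart x a).
by rewrite -(chart_imageT (replace x a c)).
Qed.

(** Moving along a vector of the [a]-th factor leaves the other points fixed, so the derivative is
    taken inside the slice through [x]. *)
Lemma derive_slice x a Z v : smooth_vf Z ->
  proj_row a ('D_(inj_row a v) (vf_rep x Z) (cmap x x)) =
  'D_v (vf_rep (x a) (slice x a Z)) (cmap (x a) (x a)).
Proof.
move=> Zs.
have xE : cmap x x = slice_base x a + inj_row a (cmap (x a) (x a)).
  rewrite -(proj_rowK (cmap x x)) -[RHS]proj_rowK; apply: eq_join_rows => b.
  by rewrite proj_slice power_map_proj; case: eqP => // ->.
have Zd := vf_rep_differentiable Zs (chart_center x).
have E : \forall w \near cmap (x a) (x a), vf_rep (x a) (slice x a Z) w =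
    (proj_row a \o vf_rep x Z) (slice_base x a + inj_row a w).
  apply: filterS (near_chart (chart_center (x a))) => w wc.
  by rewrite -vf_rep_slice // replace_id.
rewrite (near_eq_derive v E).
rewrite (derive_comp_affine (inj_row a) (slice_base x a)
  (proj_row a \o vf_rep x Z)).
rewrite -xE; apply/esym.
exact: (derive_linear _ (@proj_row_continuous R m n a) Zd).2.
Qed.

(** As long as the [a]-th point is [x a], its tangent space is read in the chart of index [x a]
    itself, so the coordinate component is the [a]-th row of [Z] unchanged. *)
Lemma vf_rep_fixed_ker eta x a Z u :
  (forall y, ker_form (power_form eta) y (Z y)) ->
  (cmap x @` cdom x) u -> proj_row a u = cmap (x a) (x a) ->
  ker_form eta (x a) (proj_row a (vf_rep x Z u)).
Proof.
move=> Zk ux ua; rewrite vf_rep_power // join_rowsK.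
have ya : cinv x u a = x a.
  by rewrite /= /power_inv ua cmapK //; exact: cdom_center.
rewrite ya diff_transition_id; last exact: chart_center.
by have /ker_power_form/(_ a) := Zk (cinv x u); rewrite ya.
Qed.

(* With the [a]-th point kept fixed, the [a]-th component of [Z] stays in a
   fixed fibre of [ker eta], and so do its derivatives. *)
Lemma derive_fixed_ker eta x a Z v : smooth_vf Z ->
  (forall y, ker_form (power_form eta) y (Z y)) -> proj_row a v = 0 ->
  ker_form eta (x a) (proj_row a ('D_v (vf_rep x Z) (cmap x x))).
Proof.
move=> Zs Zk va.
have Zd := vf_rep_differentiable Zs (chart_center x).
have [pd pE] := derive_linear v (@proj_row_continuous R m n a) Zd.
have [_ qE] := derive_linear v (@mulmxr_continuous R n k (eta (x a))) pd.
(* Taking the [a]-th row and multiplying by the fixed matrix [eta (x a)] both commute with the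
   derivative. What remains is the derivative of a function that vanishes along the line, since [v]
   does not move the [a]-th point. *)
rewrite /ker_form /= -pE; apply: etrans (esym qE) _.
apply: derive_line0; last first.
  apply: vf_rep_fixed_ker => //; first exact: chart_center.
  by rewrite power_map_proj.
have lc : {for (0 : R), continuous (fun h : R => h *: v + cmap x x)}.
  apply: cvgD; last exact: cvg_cst.
  exact: scalel_continuous.
have near_x : \forall h \near (0 : R), (cmap x @` cdom x) (h *: v + cmap x x).
  apply: lc; rewrite scale0r add0r; exact: near_chart (chart_center x).
apply: cvg_within; apply: filterS near_x => h hx.
apply: vf_rep_fixed_ker => //.
by rewrite linearD linearZ /= va scaler0 add0r power_map_proj.
Qed.

Lemma Hamiltonian_power_vf eta (Y : N -> 'rV[R]_n) :
  form_Hamiltonian eta Y ->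
  form_Hamiltonian (power_form eta) (power_vf (fun=> Y) : P -> 'rV[R]_(m * n)).
Proof.
case=> Ys YH; split; first exact: smooth_power_vfT.
move=> Z Zs Zk x; apply/ker_power_form => a.
have Zd := vf_rep_differentiable Zs (chart_center x).
(* The part of the direction that moves only the points other than the [a]-th. *)
set w := power_vf (fun=> Y) x - inj_row a (Y (x a)).
have wa : proj_row a w = 0 by rewrite linearB /= !join_rowsK eqxx subrr.
have DE : 'D_(power_vf (fun=> Y) x) (vf_rep x Z) (cmap x x) =
    'D_(inj_row a (Y (x a))) (vf_rep x Z) (cmap x x) +
    'D_w (vf_rep x Z) (cmap x x).
  by rewrite !deriveE // -linearD /w addrC subrK.
have sk z : ker_form eta z (slice x a Z z).
  by have /ker_power_form/(_ a) := Zk (replace x a z); rewrite replaceE.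
(* The [a]-th row of the derivative of the prolongation along [Z] is the derivative of [Y] along the
   slice of [Z]. Together with the slice part of the derivative of [Z] it makes up a bracket on
   [N]. *)
have E : proj_row a (bracket (power_vf (fun=> Y)) Z x) =
    bracket Y (slice x a Z) (x a) + proj_row a ('D_w (vf_rep x Z) (cmap x x)).
  rewrite /bracket DE.
  have proj_rowDB (A B C : 'rV[R]_(m * n)) :
      proj_row a (A + B - C) = proj_row a A - proj_row a C + proj_row a B.
    by rewrite linearB linearD addrAC.
  apply: etrans (proj_rowDB _ _ _) _; congr (_ - _ + _).
    exact: derive_slice.
  rewrite (derive_power_vf (W := fun=> Y)) // join_rowsK.
  by rewrite /slice replace_id.
have bk := YH _ (smooth_slice x a Zs) sk (x a).
have dk := derive_fixed_ker x Zs Zk wa.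
by rewrite /ker_form /= E mulmxDl bk dk addr0.
Qed.

End Hamiltonian.

(** * Lie systems on a power of a manifold *)

Section Lie_systems.
Context {R : realType} {n : nat} {N : manifold R n} {ell : nat}.
Local Notation P := (power_manifold N ell).
Local Notation m := ell.+1.
Implicit Types (Y Z : N -> 'rV[R]_n).

(** The prolongation of a single field, isolated so that it can be declared linear;
    [prolongation ell X t] is convertible to [diagonal_vf (X t)]. *)
Definition diagonal_vf Y : P -> 'rV[R]_(m * n) := power_vf (fun=> Y).

Lemma diagonal_vf_linear : linear diagonal_vf.
Proof.
move=> s Y Z; apply/funext => x; apply: (can_inj (@proj_rowK R m n)).
apply/funext => a; rewrite join_rowsK.
have -> : (s *: diagonal_vf Y + diagonal_vf Z) x =
  s *: diagonal_vf Y x + diagonal_vf Z x by [].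
by rewrite linearP /= !join_rowsK.
Qed.
HB.instance Definition _ :=
  GRing.isLinear.Build R (N -> 'rV[R]_n) (P -> 'rV[R]_(m * n)) _ diagonal_vf
    diagonal_vf_linear.

(** At the diagonal point [fun=> z] every row of the prolongation is [Y z], and row [ord0] exists
    because there are [ell.+1] factors. *)
Lemma diagonal_vf_eq0 Y : diagonal_vf Y = 0 -> Y = 0.
Proof.
move=> Y0; apply/funext => z.
have := congr1 (fun F : P -> 'rV[R]_(m * n) => proj_row ord0 (F (fun=> z))) Y0.
rewrite /= /diagonal_vf /power_vf join_rowsK => ->; exact: linear0.
Qed.

Lemma Lie_algebra_diagonal (V : set (N -> 'rV[R]_n)) :
  Lie_algebra V -> Lie_algebra (diagonal_vf @` V).
Proof.
case=> Vs V0 Vl Vb; split.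
- by move=> _ [Y YV <-]; apply: smooth_power_vfT => _; exact: Vs.
- by exists 0 => //; exact: linear0.
- move=> a b _ _ [Y YV <-] [Z ZV <-]; exists (a *: Y + b *: Z); first exact: Vl.
  by rewrite linearD !linearZ.
- move=> _ _ [Y YV <-] [Z ZV <-]; exists (bracket Y Z); first exact: Vb.
  by rewrite /diagonal_vf bracket_power_vf // => _; exact: Vs.
Qed.

(** Keeping time as a coordinate makes this a linear map, so joint smoothness in time and position
    follows by composition. *)
Definition proj_time (a : 'I_m) (p : R * 'rV[R]_(m * n)) : R * 'rV[R]_n :=
  (p.1, proj_row a p.2).

Lemma proj_time_linear a : linear (proj_time a).
Proof. by move=> s [t u] [t' u']; rewrite /proj_time /= linearP. Qed.
HB.instance Definition _ a :=
  GRing.isLinear.Build R (R * 'rV[R]_(m * n))%type (R * 'rV[R]_n)%type _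
    (proj_time a) (proj_time_linear a).

Lemma proj_time_continuous a : continuous (proj_time a).
Proof.
move=> p; apply: (@cvg_pair _ _ _ _ (nbhs p.1) (nbhs (proj_row a p.2)));
  first exact: cvg_fst.
by apply: (@cvg_comp _ _ _ snd (proj_row a) _ (nbhs p.2));
  [exact: cvg_snd | exact: proj_row_continuous].
Qed.

Lemma smooth_tvf_prolongation (X : R -> N -> 'rV[R]_n) :
  smooth_tvf X -> smooth_tvf (prolongation ell X).
Proof.
move=> Xs c; set Q := (X in smooth_on X).
have Qo : open Q.
  rewrite openE => -[t u] [/= _ uc].
  exists (setT, cmap c @` cdom c); last by case.
  by split; [exact: filterT | exact: near_chart].
apply: (@smooth_on_eq _ _ _ _ (fun p => join_rows (fun a =>
    vf_rep (c a) (X p.1) (proj_row a p.2)))) => //.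
  by move=> p [_ pc]; rewrite -vf_rep_power_vf.
apply: (@smooth_on_join_rows _ _ _ _ _
  (fun a (p : R * 'rV[R]_(m * n)) =>
    vf_rep (c a) (X p.1) (proj_row a p.2))) => // a.
have Xa := smooth_on_comp_affine (L := proj_time a) (p := 0)
  (@proj_time_continuous a) (Xs (c a)).
apply: smooth_on_eq Qo _ (smooth_on_sub _ Xa) => [p _|p [_ pc]].
  by rewrite add0r.
rewrite /= add0r; split=> //.
by move/power_chart_dom : pc; apply.
Qed.

(** The coefficients [b] stay the same; injectivity of the prolongation keeps the generators
    independent. *)
Lemma Lie_system_prolongation (X : R -> N -> 'rV[R]_n) :
  Lie_system X -> Lie_system (prolongation ell X).
Proof.
case=> Xs [r [b [Z [Zf ZL XZ]]]]; split; first exact: smooth_tvf_prolongation.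
exists r, b, (fun i => diagonal_vf (Z i)).
have lin (a : 'I_r -> R) :
    \sum_i a i *: diagonal_vf (Z i) = diagonal_vf (\sum_i a i *: Z i).
  by rewrite linear_sum; apply: eq_bigr => i _; rewrite linearZ.
split.
- by move=> a; rewrite lin => /diagonal_vf_eq0; exact: Zf.
- have := Lie_algebra_diagonal ZL; congr Lie_algebra.
  apply/seteqP; split => [_ [_ [a ->] <-]|_ [a ->]].
    by exists a; rewrite lin.
  by exists (\sum_i a i *: Z i); [exists a | rewrite lin].
- by move=> t; rewrite lin -XZ.
Qed.

Lemma smallest_Lie_algebra_prolongation (X : R -> N -> 'rV[R]_n) :
  Lie_system X -> smallest_Lie_algebra (prolongation ell X) `<=`
    diagonal_vf @` smallest_Lie_algebra X.
Proof.
case=> _ [r [b [Z [_ ZL XZ]]]]; apply: smallest_sub.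
  (* The smallest Lie algebra of [X] is a Lie algebra because all [X t] lie in the one spanned by
     [Z]. *)
  apply: Lie_algebra_diagonal; apply: Lie_algebra_smallest ZL _.
  by move=> _ [t _ <-]; exists (b^~ t).
by move=> _ [t _ <-]; exists (X t) => //; apply: sub_gen_smallest; exists t.
Qed.

End Lie_systems.

Theorem proposition9p4 (R : realType) (n : nat) (N : manifold R n)
    (k ell : nat) (X : R -> N -> 'rV[R]_n) :
  (1 <= k)%N ->
  is_contact_Lie_system k X ->
  is_contact_Lie_system (k * ell.+1) (prolongation ell X).
Proof.
move=> _ [eta [eta_contact XL XH]].
(* The values of [power_form eta] come as [ell.+1] blocks of length [k], so the factors of the
   dimension are exchanged. *)
rewrite [(k * _)%N]mulnC; exists (power_form eta); split.
- exact: contact_power_form.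
- exact: Lie_system_prolongation.
- move=> _ /(smallest_Lie_algebra_prolongation XL)[Y YX <-].
  exact/Hamiltonian_power_vf/XH.
Qed.
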